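(* Let $G\dashv R$ be a monoidal adjunction with $G\colon\mathcal{C}\to\mathcal{D}$ and $R\colon\mathcal{D}\to\mathcal{C}$ such that the projection formula holds for $R$. Then $$(-\otimes R\mathbb{1})\xrightarrow{\ \mathrm{lproj}_{-,\mathbb{1}}\ }RG(-)$$ is an isomorphism of monoidal monads on $\mathcal{C}$.
   Context: Conventions: monoidal categories are written as if strict. Lax monoidal functors $F$ have structure maps $\mathrm{lax}^F_{X,Y}\colon FX\otimes FY\to F(X\otimes Y)$, $\mathrm{lax}^F_0\colon\mathbb{1}\to F\mathbb{1}$. A monoidal adjunction is an adjunction with $G,R$ lax monoidal and monoidal unit and counit (then $G$ is strong). A monoidal monad is a monad on a monoidal category with a lax monoidal structure such that its unit and multiplication are monoidal transformations; an isomorphism of monoidal monads is an isomorphism of monads that is a monoidal transformation. For a monoidal adjunction, $RG$ is a monoidal monad with unit $\mathrm{unit}$, multiplication $R(\mathrm{counit}_G)$ and the composite lax structure. Projection formula: $\mathrm{lproj}_{A,X}=\mathrm{lax}^R_{GA,X}(\mathrm{unit}_A\otimes RX)\colon A\otimes RX\to R(GA\otimes X)$ and $\mathrm{rproj}_{X,A}=\mathrm{lax}^R_{X,GA}(RX\otimes\mathrm{unit}_A)\colon RX\otimes A\to R(X\otimes GA)$ are isomorphisms for all $A\in\mathcal{C}$, $X\in\mathcal{D}$. Monoidal monad structure on $-\otimes R\mathbb{1}$: $M=R\mathbb{1}$ is a monoid with unit $\mathrm{unit}^M=\mathrm{lax}^R_0$ and multiplication $\mathrm{mul}^M=\mathrm{lax}^R_{\mathbb{1},\mathbb{1}}$,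 and together with the half-braiding $\mathrm{swap}_A=(\mathrm{lproj}_{A,\mathbb{1}})^{-1}\circ\mathrm{rproj}_{\mathbb{1},A}\colon M\otimes A\to R(GA)\to A\otimes M$ it is a commutative monoid in the Drinfeld center $\mathcal{Z}(\mathcal{C})$. The monad $-\otimes M$ has unit $A\otimes\mathrm{unit}^M$, multiplication $A\otimes\mathrm{mul}^M$ and lax structure $\mathrm{lax}_0=\mathrm{unit}^M$, $\mathrm{lax}_{A,B}=(A\otimes B\otimes\mathrm{mul}^M)(A\otimes\mathrm{swap}_B\otimes M)$. *)

(* Defs.v *)
From Corelib Require Import ssreflect.
Set Implicit Arguments.
Unset Strict Implicit.
Unset Printing Implicit Defensive.

Declare Scope cat_scope.
Delimit Scope cat_scope with cat.
Local Open Scope cat_scope.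

Reserved Notation "X ~> Y" (at level 70, no associativity).
Reserved Notation "g ∘ f" (at level 50, left associativity).
Reserved Notation "X ⊗ Y" (at level 40, left associativity).
Reserved Notation "f ⊗₁ g" (at level 40, left associativity).

(** ** Categories, functors, natural transformations *)

Record category := Category {
  ob :> Type;
  hom : ob -> ob -> Type;
  idm : forall X, hom X X;
  comp : forall X Y Z, hom Y Z -> hom X Y -> hom X Z;
  comp_id_l : forall X Y (f : hom X Y), comp (idm Y) f = f;
  comp_id_r : forall X Y (f : hom X Y), comp f (idm X) = f;
  comp_assoc : forall X Y Z W (h : hom Z W) (g : hom Y Z) (f : hom X Y),
    comp h (comp g f) = comp (comp h g) f
}.
Arguments hom {c} X Y.
Arguments idm {c} X.
Arguments comp {c X Y Z} g f.

Notation "X ~> Y" := (hom X Y) : cat_scope.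
Notation "g ∘ f" := (comp g f) : cat_scope.

Definition is_inverse (C : category) (X Y : C) (f : X ~> Y) (g : Y ~> X) : Prop :=
  g ∘ f = idm X /\ f ∘ g = idm Y.

(* The inverse is carried as data so that it can be used in definitions;
   it is unique, so this is a property of [f]. *)
Record is_iso (C : category) (X Y : C) (f : X ~> Y) : Type := IsIso {
  inv_of : Y ~> X;
  inv_ofP : is_inverse f inv_of
}.

Record iso (C : category) (X Y : C) : Type := Iso {
  fwd : X ~> Y;
  bwd : Y ~> X;
  isoP : is_inverse fwd bwd
}.

Record functor (C D : category) := Functor {
  fob :> C -> D;
  fmap : forall X Y, (X ~> Y) -> (fob X ~> fob Y);
  fmap_id : forall X, fmap (idm X) = idm (fob X);
  fmap_comp : forall X Y Z (g : Y ~> Z) (f : X ~> Y),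
    fmap (g ∘ f) = fmap g ∘ fmap f
}.
Arguments fmap {C D} F {X Y} f : rename.

Definition functor_id (C : category) : functor C C :=
  @Functor C C (fun X => X) (fun X Y f => f)
    (fun X => eq_refl) (fun X Y Z g f => eq_refl).

Definition functor_comp (C D E : category)
  (G : functor D E) (F : functor C D) : functor C E.
Proof.
refine (@Functor C E (fun X => G (F X)) (fun X Y f => fmap G (fmap F f)) _ _).
- by move=> X; rewrite !fmap_id.
- by move=> X Y Z g f; rewrite !fmap_comp.
Defined.

Record nat_trans (C D : category) (F G : functor C D) := NatTrans {
  component :> forall X : C, F X ~> G X;
  naturality : forall (X Y : C) (f : X ~> Y),
    component Y ∘ fmap F f = fmap G f ∘ component X
}.

(** ** Monoidal categories *)

Record monoidal_category := MonoidalCategory {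
  mcat :> category;
  tensor : mcat -> mcat -> mcat;
  tensor_hom : forall X X' Y Y' : mcat,
    (X ~> X') -> (Y ~> Y') -> (tensor X Y ~> tensor X' Y');
  tunit : mcat;
  assoc : forall X Y Z, iso (tensor (tensor X Y) Z) (tensor X (tensor Y Z));
  lunit : forall X, iso (tensor tunit X) X;
  runit : forall X, iso (tensor X tunit) X;
  tensor_hom_id : forall X Y,
    tensor_hom (idm X) (idm Y) = idm (tensor X Y);
  tensor_hom_comp : forall X X' X'' Y Y' Y''
      (f' : X' ~> X'') (f : X ~> X') (g' : Y' ~> Y'') (g : Y ~> Y'),
    tensor_hom (f' ∘ f) (g' ∘ g) = tensor_hom f' g' ∘ tensor_hom f g;
  assoc_natural : forall X X' Y Y' Z Z' (f : X ~> X') (g : Y ~> Y') (h : Z ~> Z'),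
    fwd (assoc X' Y' Z') ∘ tensor_hom (tensor_hom f g) h
    = tensor_hom f (tensor_hom g h) ∘ fwd (assoc X Y Z);
  lunit_natural : forall X Y (f : X ~> Y),
    fwd (lunit Y) ∘ tensor_hom (idm tunit) f = f ∘ fwd (lunit X);
  runit_natural : forall X Y (f : X ~> Y),
    fwd (runit Y) ∘ tensor_hom f (idm tunit) = f ∘ fwd (runit X);
  triangle : forall X Y,
    tensor_hom (idm X) (fwd (lunit Y)) ∘ fwd (assoc X tunit Y)
    = tensor_hom (fwd (runit X)) (idm Y);
  pentagon : forall W X Y Z,
    tensor_hom (idm W) (fwd (assoc X Y Z))
      ∘ fwd (assoc W (tensor X Y) Z)
      ∘ tensor_hom (fwd (assoc W X Y)) (idm Z)
    = fwd (assoc W X (tensor Y Z)) ∘ fwd (assoc (tensor W X) Y Z)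
}.
Arguments tensor {m} X Y.
Arguments tensor_hom {m X X' Y Y'} f g.
Arguments tunit {m}.
Arguments assoc {m} X Y Z.
Arguments lunit {m} X.
Arguments runit {m} X.

Notation "X ⊗ Y" := (tensor X Y) : cat_scope.
Notation "f ⊗₁ g" := (tensor_hom f g) : cat_scope.
Notation "𝟙" := tunit : cat_scope.

(** ** Lax monoidal functors and monoidal transformations *)

Record lax_data (C D : monoidal_category) (F : functor C D) := LaxData {
  lax0 : 𝟙 ~> F 𝟙;
  lax : forall X Y : C, F X ⊗ F Y ~> F (X ⊗ Y)
}.
Arguments lax0 {C D F} L : rename.
Arguments lax {C D F} L X Y : rename.

Record is_lax_monoidal (C D : monoidal_category) (F : functor C D)
    (L : lax_data F) : Prop := IsLaxMonoidal {
  lax_natural : forall (X X' Y Y' : C) (f : X ~> X') (g : Y ~> Y'),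
    lax L X' Y' ∘ (fmap F f ⊗₁ fmap F g) = fmap F (f ⊗₁ g) ∘ lax L X Y;
  lax_assoc : forall X Y Z : C,
    fmap F (fwd (assoc X Y Z)) ∘ lax L (X ⊗ Y) Z ∘ (lax L X Y ⊗₁ idm (F Z))
    = lax L X (Y ⊗ Z) ∘ (idm (F X) ⊗₁ lax L Y Z)
        ∘ fwd (assoc (F X) (F Y) (F Z));
  lax_lunit : forall X : C,
    fmap F (fwd (lunit X)) ∘ lax L 𝟙 X ∘ (lax0 L ⊗₁ idm (F X))
    = fwd (lunit (F X));
  lax_runit : forall X : C,
    fmap F (fwd (runit X)) ∘ lax L X 𝟙 ∘ (idm (F X) ⊗₁ lax0 L)
    = fwd (runit (F X))
}.

Definition lax_id (C : monoidal_category) : lax_data (functor_id C) :=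
  @LaxData C C (functor_id C) (idm 𝟙) (fun X Y => idm (X ⊗ Y)).

Definition lax_comp (C D E : monoidal_category)
    (G : functor D E) (F : functor C D) (LG : lax_data G) (LF : lax_data F) :
    lax_data (functor_comp G F) :=
  @LaxData C E (functor_comp G F)
    (fmap G (lax0 LF) ∘ lax0 LG)
    (fun X Y => fmap G (lax LF X Y) ∘ lax LG (F X) (F Y)).

Record is_monoidal_trans (C D : monoidal_category) (F G : functor C D)
    (LF : lax_data F) (LG : lax_data G) (t : nat_trans F G) : Prop :=
  IsMonoidalTrans {
  trans_lax0 : t 𝟙 ∘ lax0 LF = lax0 LG;
  trans_lax : forall X Y : C,
    t (X ⊗ Y) ∘ lax LF X Y = lax LG X Y ∘ (t X ⊗₁ t Y)
}.

(** ** Monoidal monads *)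

Record monoidal_monad_data (C : monoidal_category) := MonoidalMonadData {
  mon_fun :> functor C C;
  mon_unit : nat_trans (functor_id C) mon_fun;
  mon_mul : nat_trans (functor_comp mon_fun mon_fun) mon_fun;
  mon_lax : lax_data mon_fun
}.
Arguments mon_unit {C} T : rename.
Arguments mon_mul {C} T : rename.
Arguments mon_lax {C} T : rename.

Record is_monoidal_monad (C : monoidal_category) (T : monoidal_monad_data C) :
    Prop := IsMonoidalMonad {
  mon_mul_unit_l : forall X : C, mon_mul T X ∘ mon_unit T (T X) = idm (T X);
  mon_mul_unit_r : forall X : C, mon_mul T X ∘ fmap T (mon_unit T X) = idm (T X);
  mon_mul_assoc : forall X : C,
    mon_mul T X ∘ mon_mul T (T X) = mon_mul T X ∘ fmap T (mon_mul T X);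
  mon_is_lax : is_lax_monoidal (mon_lax T);
  mon_unit_monoidal : is_monoidal_trans (lax_id C) (mon_lax T) (mon_unit T);
  mon_mul_monoidal :
    is_monoidal_trans (lax_comp (mon_lax T) (mon_lax T)) (mon_lax T) (mon_mul T)
}.

(* The monoidal monad laws of source and target are included, so that the
   notion applies to bare [monoidal_monad_data]. *)
Record is_monoidal_monad_iso (C : monoidal_category)
    (S T : monoidal_monad_data C) (t : nat_trans S T) : Prop :=
  IsMonoidalMonadIso {
  iso_source : is_monoidal_monad S;
  iso_target : is_monoidal_monad T;
  iso_unit : forall X : C, t X ∘ mon_unit S X = mon_unit T X;
  iso_mul : forall X : C,
    t X ∘ mon_mul S X = mon_mul T X ∘ (t (T X) ∘ fmap S (t X));
  iso_monoidal : is_monoidal_trans (mon_lax S) (mon_lax T) t;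
  iso_invertible : forall X : C, exists u : T X ~> S X, is_inverse (t X) u
}.

(** ** Monoidal adjunctions *)

Record monoidal_adjunction (C D : monoidal_category) := MonoidalAdjunction {
  ladj : functor C D;
  radj : functor D C;
  llax : lax_data ladj;
  rlax : lax_data radj;
  adj_unit : nat_trans (functor_id C) (functor_comp radj ladj);
  adj_counit : nat_trans (functor_comp ladj radj) (functor_id D);
  adj_triangle_l : forall A : C,
    adj_counit (ladj A) ∘ fmap ladj (adj_unit A) = idm (ladj A);
  adj_triangle_r : forall X : D,
    fmap radj (adj_counit X) ∘ adj_unit (radj X) = idm (radj X);
  llax_monoidal : is_lax_monoidal llax;
  rlax_monoidal : is_lax_monoidal rlax;
  adj_unit_monoidal : is_monoidal_trans (lax_id C) (lax_comp rlax llax) adj_unit;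
  adj_counit_monoidal : is_monoidal_trans (lax_comp llax rlax) (lax_id D) adj_counit
}.
Arguments ladj {C D} adj : rename.
Arguments radj {C D} adj : rename.
Arguments llax {C D} adj : rename.
Arguments rlax {C D} adj : rename.
Arguments adj_unit {C D} adj : rename.
Arguments adj_counit {C D} adj : rename.

Section AdjunctionMonads.

Variables (C D : monoidal_category) (adj : monoidal_adjunction C D).

Local Notation G := (ladj adj).
Local Notation R := (radj adj).
Local Notation η := (adj_unit adj).
Local Notation ε := (adj_counit adj).

Definition adj_mul :
  nat_trans (functor_comp (functor_comp R G) (functor_comp R G)) (functor_comp R G).
Proof.
refine (@NatTrans _ _ (functor_comp (functor_comp R G) (functor_comp R G))
  (functor_comp R G) (fun A => fmap R (ε (G A))) _).
move=> A B f /=; rewrite -!fmap_comp; congr (fmap R _).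
exact: (naturality ε (fmap G f)).
Defined.

Definition adj_monad : monoidal_monad_data C :=
  MonoidalMonadData η adj_mul (lax_comp (rlax adj) (llax adj)).

Definition lproj (A : C) (X : D) : A ⊗ R X ~> R (G A ⊗ X) :=
  lax (rlax adj) (G A) X ∘ (η A ⊗₁ idm (R X)).

Definition rproj (X : D) (A : C) : R X ⊗ A ~> R (X ⊗ G A) :=
  lax (rlax adj) X (G A) ∘ (idm (R X) ⊗₁ η A).

Record projection_formula := ProjectionFormula {
  lproj_iso : forall A X, is_iso (lproj A X);
  rproj_iso : forall X A, is_iso (rproj X A)
}.

Local Notation M := (R 𝟙).

Definition unitM : 𝟙 ~> M := lax0 (rlax adj).

Definition mulM : M ⊗ M ~> M :=
  fmap R (fwd (lunit 𝟙)) ∘ lax (rlax adj) 𝟙 𝟙.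

(* In the strict case both projection maps below land in [R (G A)]. *)
Definition lproj1_fun (A : C) : A ⊗ M ~> R (G A) :=
  fmap R (fwd (runit (G A))) ∘ lproj A 𝟙.

Definition rproj1 (A : C) : M ⊗ A ~> R (G A) :=
  fmap R (fwd (lunit (G A))) ∘ rproj 𝟙 A.

Definition swap (pf : projection_formula) (A : C) : M ⊗ A ~> A ⊗ M :=
  inv_of (lproj_iso pf A 𝟙) ∘ fmap R (bwd (runit (G A))) ∘ rproj1 A.

Definition tensorM : functor C C.
Proof.
refine (@Functor C C (fun A => A ⊗ M) (fun A B f => f ⊗₁ idm M) _ _).
- by move=> A; rewrite tensor_hom_id.
- by move=> X Y Z g f; rewrite -tensor_hom_comp comp_id_l.
Defined.

Definition tensorM_unit : nat_trans (functor_id C) tensorM.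
Proof.
refine (@NatTrans _ _ (functor_id C) tensorM
  (fun A => (idm A ⊗₁ unitM) ∘ bwd (runit A)) _).
move=> A B f /=.
have [KA _] := isoP (runit B).
have [_ KB] := isoP (runit A).
have E : bwd (runit B) ∘ f = (f ⊗₁ idm 𝟙) ∘ bwd (runit A).
  rewrite -[LHS]comp_id_r -KB -comp_assoc [f ∘ _]comp_assoc -runit_natural.
  by rewrite !comp_assoc KA comp_id_l.
rewrite -comp_assoc E !comp_assoc -!tensor_hom_comp.
by rewrite !comp_id_l !comp_id_r.
Defined.

Definition tensorM_mul : nat_trans (functor_comp tensorM tensorM) tensorM.
Proof.
refine (@NatTrans _ _ (functor_comp tensorM tensorM) tensorM
  (fun A => (idm A ⊗₁ mulM) ∘ fwd (assoc A M M)) _).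
move=> A B f /=; rewrite -comp_assoc assoc_natural !comp_assoc -!tensor_hom_comp.
by rewrite tensor_hom_id !comp_id_l !comp_id_r.
Defined.

(* (A ⊗ M) ⊗ (B ⊗ M) --> A ⊗ ((M ⊗ B) ⊗ M) --> A ⊗ ((B ⊗ M) ⊗ M)
   --> (A ⊗ B) ⊗ (M ⊗ M) --> (A ⊗ B) ⊗ M *)
Definition tensorM_lax (pf : projection_formula) : lax_data tensorM :=
  @LaxData C C tensorM
    (bwd (lunit M) ∘ unitM)
    (fun A B =>
       (idm (A ⊗ B) ⊗₁ mulM)
       ∘ (bwd (assoc A B (M ⊗ M)) ∘ (idm A ⊗₁ fwd (assoc B M M)))
       ∘ (idm A ⊗₁ (swap pf B ⊗₁ idm M))
       ∘ ((idm A ⊗₁ bwd (assoc M B M)) ∘ fwd (assoc A M (B ⊗ M)))).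

Definition tensorM_monad (pf : projection_formula) : monoidal_monad_data C :=
  MonoidalMonadData tensorM_unit tensorM_mul (tensorM_lax pf).

Definition lproj1 : nat_trans tensorM (functor_comp R G).
Proof.
refine (@NatTrans _ _ tensorM (functor_comp R G) lproj1_fun _).
move=> A B f; rewrite /lproj1_fun /lproj /=.
have nη := naturality η f; rewrite /= in nη.
have E : (η B ∘ f) ⊗₁ (idm M ∘ idm M)
    = (fmap R (fmap G f) ⊗₁ fmap R (idm 𝟙)) ∘ (η A ⊗₁ idm M).
  by rewrite -tensor_hom_comp fmap_id nη.
rewrite -!comp_assoc -tensor_hom_comp E.
rewrite [lax _ _ _ ∘ _]comp_assoc (lax_natural (rlax_monoidal adj)).
by rewrite !comp_assoc -!fmap_comp runit_natural.
Defined.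

End AdjunctionMonads.

(* Main.v *)
(* Since lproj is invertible and compatible with units, multiplications and lax
   structures, the monoidal monad laws of (- ⊗ R𝟙) follow from those of RG, which
   hold because unit and counit are monoidal.
   For f : X ~> R P and g : Y ~> R Q write f • g := lax ∘ (f ⊗ g). Then
   lproj_{A,𝟙} is η A • id up to the right unitor. The product • is natural,
   associative and unital, and swap moves η B past id_M by definition, so every
   compatibility reduces to rebracketing products of η's and identities, leaving
   a coherence identity in D. *)
Require Import Defs.
From Corelib Require Import ssreflect ssrfun.

Local Open Scope cat_scope.

(** * Rewriting inside composites, and closure properties of inverses *)

(** In a left-bracketed composite the last factors are not a subterm; this lemma and the next let an
    equation about them be used there. *)
Lemma comp_cancel {C : category} {X Y Z W : C} {g : Y ~> Z} {f : X ~> Y}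
    {k : X ~> Z} (E : g ∘ f = k) (h : Z ~> W) : h ∘ g ∘ f = h ∘ k.
Proof. by rewrite -comp_assoc E. Qed.

Lemma comp_cancel3 {C : category} {X Y Z W V : C} {g : Z ~> W} {g' : Y ~> Z}
    {f : X ~> Y} {k : X ~> W} (E : g ∘ g' ∘ f = k) (h : W ~> V) :
  h ∘ g ∘ g' ∘ f = h ∘ k.
Proof. by rewrite -E !comp_assoc. Qed.

Lemma is_inverse_mono {C : category} {X Y Z : C} {f : X ~> Y} {g : Y ~> X}
    {u v : Z ~> X} (fg : is_inverse f g) : f ∘ u = f ∘ v -> u = v.
Proof.
case: fg => gf _ E.
by rewrite -(comp_id_l u) -gf -comp_assoc E comp_assoc gf comp_id_l.
Qed.

Lemma is_inverse_epi {C : category} {X Y Z : C} {f : X ~> Y} {g : Y ~> X}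
    {u v : Y ~> Z} (fg : is_inverse f g) : u ∘ f = v ∘ f -> u = v.
Proof.
case: fg => _ fgK E.
by rewrite -(comp_id_r u) -fgK comp_assoc E -comp_assoc fgK comp_id_r.
Qed.

Lemma is_inverse_comp {C : category} {X Y Z : C} {f : X ~> Y} {f' : Y ~> X}
    {g : Y ~> Z} {g' : Z ~> Y} :
  is_inverse f f' -> is_inverse g g' -> is_inverse (g ∘ f) (f' ∘ g').
Proof.
move=> [f'f ff'] [g'g gg']; split.
- by rewrite comp_assoc (comp_cancel g'g) comp_id_r.
- by rewrite comp_assoc (comp_cancel ff') comp_id_r.
Qed.

Lemma is_inverse_fmap {C D : category} (F : functor C D) {X Y : C}
    {f : X ~> Y} {g : Y ~> X} :
  is_inverse f g -> is_inverse (fmap F f) (fmap F g).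
Proof. by move=> [gf fg]; split; rewrite -fmap_comp ?gf ?fg fmap_id. Qed.

Lemma bwdK {C : category} {X Y : C} (i : iso X Y) : bwd i ∘ fwd i = idm X.
Proof. by case: (isoP i). Qed.

Lemma fwdK {C : category} {X Y : C} (i : iso X Y) : fwd i ∘ bwd i = idm Y.
Proof. by case: (isoP i). Qed.

(** * Unit coherence in a monoidal category *)

Section MonoidalCategory.

Context {C : monoidal_category}.
Implicit Types X Y Z : C.

Lemma tensor_compl {X Y Z} W (g : Y ~> Z) (f : X ~> Y) :
  (g ∘ f) ⊗₁ idm W = (g ⊗₁ idm W) ∘ (f ⊗₁ idm W).
Proof. by rewrite -tensor_hom_comp comp_id_l. Qed.

Lemma tensor_compr {X Y Z} W (g : Y ~> Z) (f : X ~> Y) :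
  idm W ⊗₁ (g ∘ f) = (idm W ⊗₁ g) ∘ (idm W ⊗₁ f).
Proof. by rewrite -tensor_hom_comp comp_id_l. Qed.

Lemma is_inverse_tensor {X X' Y Y'} {f : X ~> X'} {f' : X' ~> X}
    {g : Y ~> Y'} {g' : Y' ~> Y} :
  is_inverse f f' -> is_inverse g g' -> is_inverse (f ⊗₁ g) (f' ⊗₁ g').
Proof.
move=> [f'f ff'] [g'g gg'].
by split; rewrite -tensor_hom_comp ?f'f ?g'g ?ff' ?gg' tensor_hom_id.
Qed.

Lemma is_inverse_id X : is_inverse (idm X) (idm X).
Proof. by split; rewrite comp_id_l. Qed.

Lemma tunit_tensor_faithful {X Y} (f g : X ~> Y) :
  idm (𝟙 : C) ⊗₁ f = idm 𝟙 ⊗₁ g -> f = g.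
Proof.
move=> E; apply: (is_inverse_epi (isoP (lunit X))).
by rewrite -!lunit_natural E.
Qed.

Lemma tensor_tunit_faithful {X Y} (f g : X ~> Y) :
  f ⊗₁ idm (𝟙 : C) = g ⊗₁ idm 𝟙 -> f = g.
Proof.
move=> E; apply: (is_inverse_epi (isoP (runit X))).
by rewrite -!runit_natural E.
Qed.

(* Kelly: this and the next two lemmas follow from triangle and pentagon. *)
Lemma lunit_tensor X Y :
  fwd (lunit (X ⊗ Y)) ∘ fwd (assoc 𝟙 X Y) = fwd (lunit X) ⊗₁ idm Y.
Proof.
apply: tunit_tensor_faithful.
(* Precomposing with these invertible associators produces the long side of the pentagon. *)
apply: (is_inverse_epi (is_inverse_comp
  (is_inverse_tensor (isoP (assoc 𝟙 𝟙 X)) (is_inverse_id Y))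
  (isoP (assoc 𝟙 (𝟙 ⊗ X) Y)))).
rewrite tensor_compr !comp_assoc.
rewrite -!(comp_assoc (idm 𝟙 ⊗₁ fwd (lunit _))) pentagon.
rewrite comp_assoc triangle -tensor_hom_id -!assoc_natural -comp_assoc.
by rewrite -tensor_compl triangle.
Qed.

Lemma runit_tensor X Y :
  (idm X ⊗₁ fwd (runit Y)) ∘ fwd (assoc X Y 𝟙) = fwd (runit (X ⊗ Y)).
Proof.
apply: tensor_tunit_faithful; apply: (is_inverse_mono (isoP (assoc X Y 𝟙))).
rewrite tensor_compl comp_assoc assoc_natural -(triangle Y) tensor_compr.
rewrite -2!(comp_assoc (idm X ⊗₁ _)) pentagon comp_assoc.
by rewrite -assoc_natural tensor_hom_id -comp_assoc triangle.
Qed.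

Lemma lunit_tunit : fwd (lunit (𝟙 : C)) = fwd (runit 𝟙).
Proof.
apply: tensor_tunit_faithful; rewrite -lunit_tensor -triangle.
(* What remains is that the left unitor at 𝟙 ⊗ 𝟙 equals 𝟙 ⊗ [lunit 𝟙], which is naturality of the
   unitor at itself. *)
congr (_ ∘ _); apply: (is_inverse_mono (isoP (lunit 𝟙))).
by rewrite lunit_natural.
Qed.

(* Both sides remove the two units from (X ⊗ 𝟙) ⊗ (Y ⊗ 𝟙): on the left the first
   one is moved across Y before both are removed together, as in [tensorM_lax]. *)
Lemma runit_swap_coherence X Y :
  fwd (runit (X ⊗ Y)) ∘ (idm (X ⊗ Y) ⊗₁ fwd (lunit 𝟙))
    ∘ bwd (assoc X Y (𝟙 ⊗ 𝟙)) ∘ (idm X ⊗₁ fwd (assoc Y 𝟙 𝟙))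
    ∘ (idm X ⊗₁ ((bwd (runit Y) ∘ fwd (lunit Y)) ⊗₁ idm 𝟙))
    ∘ (idm X ⊗₁ bwd (assoc 𝟙 Y 𝟙)) ∘ fwd (assoc X 𝟙 (Y ⊗ 𝟙))
  = fwd (runit X) ⊗₁ fwd (runit Y).
Proof.
(* The part of the path that stays to the right of [X]. *)
have inner : fwd (runit Y) ∘ (idm Y ⊗₁ fwd (lunit 𝟙)) ∘ fwd (assoc Y 𝟙 𝟙)
     ∘ ((bwd (runit Y) ∘ fwd (lunit Y)) ⊗₁ idm 𝟙) ∘ bwd (assoc 𝟙 Y 𝟙)
   = fwd (runit Y) ∘ fwd (lunit (Y ⊗ 𝟙)).
  rewrite (comp_cancel (triangle _ _)) (comp_cancel (esym (tensor_compl _ _ _))).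
  rewrite comp_assoc fwdK comp_id_l -lunit_tensor comp_assoc.
  by rewrite (comp_cancel (fwdK _)) comp_id_r.
rewrite -runit_tensor -tensor_hom_id.
rewrite (comp_cancel (assoc_natural _ _ _)) comp_assoc (comp_cancel (fwdK _)).
rewrite comp_id_r -!tensor_compr inner tensor_compr.
rewrite (comp_cancel (triangle _ _)) -tensor_hom_comp.
by rewrite comp_id_l comp_id_r.
Qed.

End MonoidalCategory.

(** * Calculus of the product f • g of maps into the image of a lax monoidal functor *)

Section LaxProduct.

Context {C D : monoidal_category} {F : functor C D} {L : lax_data F}.
Hypothesis FL : is_lax_monoidal L.

(* Locked, since otherwise rewriting with [comp_assoc] sees through it. *)
Definition lax_prod {X Y : D} {P Q : C} (f : X ~> F P) (g : Y ~> F Q) :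
  X ⊗ Y ~> F (P ⊗ Q) := locked (lax L P Q ∘ (f ⊗₁ g)).

Lemma lax_prodE {X Y : D} {P Q : C} (f : X ~> F P) (g : Y ~> F Q) :
  lax_prod f g = lax L P Q ∘ (f ⊗₁ g).
Proof. by rewrite /lax_prod -lock. Qed.

Lemma lax_prod_id (P Q : C) : lax_prod (idm (F P)) (idm (F Q)) = lax L P Q.
Proof. by rewrite !lax_prodE tensor_hom_id comp_id_r. Qed.

Lemma lax_prod_comp {X X' Y Y' : D} {P Q : C} (f : X ~> F P) (g : Y ~> F Q)
    (u : X' ~> X) (v : Y' ~> Y) :
  lax_prod (f ∘ u) (g ∘ v) = lax_prod f g ∘ (u ⊗₁ v).
Proof. by rewrite !lax_prodE tensor_hom_comp comp_assoc. Qed.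

Lemma lax_prod_fmap {X Y : D} {P P' Q Q' : C} (f : X ~> F P) (g : Y ~> F Q)
    (p : P ~> P') (q : Q ~> Q') :
  lax_prod (fmap F p ∘ f) (fmap F q ∘ g) = fmap F (p ⊗₁ q) ∘ lax_prod f g.
Proof.
by rewrite !lax_prodE tensor_hom_comp !comp_assoc (lax_natural FL).
Qed.

Lemma lax_prod_compl {X X' Y : D} {P Q : C} (f : X ~> F P) (g : Y ~> F Q)
    (u : X' ~> X) :
  lax_prod (f ∘ u) g = lax_prod f g ∘ (u ⊗₁ idm Y).
Proof. by rewrite -lax_prod_comp comp_id_r. Qed.

Lemma lax_prod_compr {X Y Y' : D} {P Q : C} (f : X ~> F P) (g : Y ~> F Q)
    (v : Y' ~> Y) :
  lax_prod f (g ∘ v) = lax_prod f g ∘ (idm X ⊗₁ v).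
Proof. by rewrite -lax_prod_comp comp_id_r. Qed.

Lemma lax_prod_fmapl {X Y : D} {P P' Q : C} (f : X ~> F P) (g : Y ~> F Q)
    (p : P ~> P') :
  lax_prod (fmap F p ∘ f) g = fmap F (p ⊗₁ idm Q) ∘ lax_prod f g.
Proof. by rewrite -lax_prod_fmap fmap_id comp_id_l. Qed.

Lemma lax_prod_fmapr {X Y : D} {P Q Q' : C} (f : X ~> F P) (g : Y ~> F Q)
    (q : Q ~> Q') :
  lax_prod f (fmap F q ∘ g) = fmap F (idm P ⊗₁ q) ∘ lax_prod f g.
Proof. by rewrite -lax_prod_fmap fmap_id comp_id_l. Qed.

Lemma lax_prod_assoc {X Y Z : D} {P Q S : C}
    (f : X ~> F P) (g : Y ~> F Q) (h : Z ~> F S) :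
  fmap F (fwd (assoc P Q S)) ∘ lax_prod (lax_prod f g) h
  = lax_prod f (lax_prod g h) ∘ fwd (assoc X Y Z).
Proof.
have -> : lax_prod (lax_prod f g) h
    = lax L (P ⊗ Q) S ∘ (lax L P Q ⊗₁ idm (F S)) ∘ ((f ⊗₁ g) ⊗₁ h).
  by rewrite !lax_prodE -comp_assoc -tensor_hom_comp comp_id_l.
have -> : lax_prod f (lax_prod g h)
    = lax L P (Q ⊗ S) ∘ (idm (F P) ⊗₁ lax L Q S) ∘ (f ⊗₁ (g ⊗₁ h)).
  by rewrite !lax_prodE -comp_assoc -tensor_hom_comp comp_id_l.
by rewrite !comp_assoc (lax_assoc FL) (comp_cancel (assoc_natural _ _ _))
  !comp_assoc.
Qed.

Lemma lax_prod_assoc_bwd {X Y Z : D} {P Q S : C}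
    (f : X ~> F P) (g : Y ~> F Q) (h : Z ~> F S) :
  lax_prod (lax_prod f g) h ∘ bwd (assoc X Y Z)
  = fmap F (bwd (assoc P Q S)) ∘ lax_prod f (lax_prod g h).
Proof.
apply: (is_inverse_epi (isoP (assoc X Y Z))).
rewrite (comp_cancel (bwdK _)) comp_id_r -comp_assoc -lax_prod_assoc.
by rewrite comp_assoc -fmap_comp bwdK fmap_id comp_id_l.
Qed.

Lemma lax_prod_unitl {X : D} {P : C} (f : X ~> F P) :
  fmap F (fwd (lunit P)) ∘ lax_prod (lax0 L) f = f ∘ fwd (lunit X).
Proof.
(* Splitting off 𝟙 ⊗ f leaves the product of [lax0] with an identity, as in the unit axiom. *)
rewrite -[f in LHS]comp_id_l -[lax0 L]comp_id_r lax_prod_comp lax_prodE.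
by rewrite !comp_assoc (lax_lunit FL) lunit_natural.
Qed.

Lemma lax_prod_unitr {X : D} {P : C} (f : X ~> F P) :
  fmap F (fwd (runit P)) ∘ lax_prod f (lax0 L) = f ∘ fwd (runit X).
Proof.
rewrite -[f in LHS]comp_id_l -[lax0 L]comp_id_r lax_prod_comp lax_prodE.
by rewrite !comp_assoc (lax_runit FL) runit_natural.
Qed.

End LaxProduct.

(** * Composition of lax monoidal functors and transport of monoidal monads *)

(** Naturality of the structure of H moves the H-image of the structure of F outwards; each
    coherence axiom then splits into the axiom of F under H and the axiom of H. *)
Lemma lax_comp_monoidal {A B E : monoidal_category} {F : functor A B}
    {H : functor B E} {LF : lax_data F} {LH : lax_data H} :
  is_lax_monoidal LF -> is_lax_monoidal LH -> is_lax_monoidal (lax_comp LH LF).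
Proof.
move=> FL HL; split=> /=.
- move=> X X' Y Y' f g.
  rewrite -comp_assoc (lax_natural HL) !comp_assoc -!fmap_comp.
  by rewrite (lax_natural FL).
- move=> X Y Z; rewrite tensor_compl tensor_compr.
  have N1 := lax_natural HL (lax LF X Y) (idm (F Z)).
  have N2 := lax_natural HL (idm (F X)) (lax LF Y Z).
  rewrite fmap_id in N1; rewrite fmap_id in N2.
  rewrite !comp_assoc (comp_cancel N1) (comp_cancel N2) !comp_assoc -!fmap_comp.
  rewrite (lax_assoc FL) !fmap_comp (comp_cancel3 (lax_assoc HL _ _ _)).
  by rewrite !comp_assoc.
- move=> X; rewrite tensor_compl.
  have N1 := lax_natural HL (lax0 LF) (idm (F X)).
  rewrite fmap_id in N1.
  rewrite !comp_assoc (comp_cancel N1) !comp_assoc -!fmap_comp.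
  by rewrite (lax_lunit FL) (lax_lunit HL).
- move=> X; rewrite tensor_compr.
  have N1 := lax_natural HL (idm (F X)) (lax0 LF).
  rewrite fmap_id in N1.
  rewrite !comp_assoc (comp_cancel N1) !comp_assoc -!fmap_comp.
  by rewrite (lax_runit FL) (lax_runit HL).
Qed.

(** Components of [t] are monic, so each law of [S] may be checked after composing with [t], where
    compatibility turns it into the corresponding law of [T]. *)
Lemma monoidal_monad_transport {C : monoidal_category}
    {S T : monoidal_monad_data C} (t : nat_trans S T)
    (t' : forall X : C, T X ~> S X) :
  (forall X, is_inverse (t X) (t' X)) ->
  (forall X, t X ∘ mon_unit S X = mon_unit T X) ->
  (forall X, t X ∘ mon_mul S X = mon_mul T X ∘ (t (T X) ∘ fmap S (t X))) ->
  is_monoidal_trans (mon_lax S) (mon_lax T) t ->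
  is_monoidal_monad T -> is_monoidal_monad S.
Proof.
move=> ti tu tm [t0 tl] [Tul Tur Tassoc TL [Tu0 Tu] [Tm0 Tm]].
have mono X Y (u v : Y ~> S X) : t X ∘ u = t X ∘ v -> u = v.
  exact: is_inverse_mono (ti X).
(* The horizontal composite of [t] with itself has two forms; in the second, naturality of the lax
   structure of [T] can absorb T(t) ⊗ T(t). *)
have tmE X : mon_mul T X ∘ (t (T X) ∘ fmap S (t X))
    = mon_mul T X ∘ (fmap T (t X) ∘ t (S X)) by rewrite naturality.
split.
- move=> X; apply: (mono); rewrite comp_assoc tm.
  have N := naturality (mon_unit S) (t X); rewrite /= in N.
  by rewrite -!comp_assoc -N (comp_assoc (t _)) tu comp_assoc Tul comp_id_l comp_id_r.
- move=> X; apply: (mono); rewrite comp_assoc tm -!comp_assoc -fmap_comp tu.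
  by rewrite naturality comp_assoc Tur comp_id_l comp_id_r.
- move=> X; apply: (mono); rewrite !comp_assoc tm.
  have N := naturality (mon_mul S) (t X); rewrite /= in N.
  rewrite -!comp_assoc -N -(fmap_comp S) tm (comp_assoc (t _)) tm.
  rewrite !fmap_comp !comp_assoc Tassoc.
  have NM := naturality t (mon_mul T X).
  by rewrite (comp_cancel NM) !comp_assoc.
- split.
  + move=> X X' Y Y' f g; apply: (mono).
    rewrite !comp_assoc tl -comp_assoc -tensor_hom_comp !naturality.
    rewrite tensor_hom_comp comp_assoc (lax_natural TL).
    by rewrite (comp_cancel (tl _ _)) comp_assoc.
  + move=> X Y Z; apply: (mono).
    rewrite !comp_assoc naturality (comp_cancel (tl _ _)) tl.
    rewrite comp_assoc.
    have E1 : (t (X ⊗ Y) ⊗₁ t Z) ∘ (lax (mon_lax S) X Y ⊗₁ idm (S Z))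
        = (lax (mon_lax T) X Y ⊗₁ idm (T Z)) ∘ ((t X ⊗₁ t Y) ⊗₁ t Z).
      by rewrite -!tensor_hom_comp tl !comp_id_l !comp_id_r.
    have E2 : (t X ⊗₁ t (Y ⊗ Z)) ∘ (idm (S X) ⊗₁ lax (mon_lax S) Y Z)
        = (idm (T X) ⊗₁ lax (mon_lax T) Y Z) ∘ (t X ⊗₁ (t Y ⊗₁ t Z)).
      by rewrite -!tensor_hom_comp tl !comp_id_l !comp_id_r.
    rewrite (comp_cancel E1) (comp_cancel E2) !comp_assoc (lax_assoc TL).
    by rewrite (comp_cancel (assoc_natural _ _ _)) !comp_assoc.
  + move=> X; apply: (mono).
    rewrite !comp_assoc naturality (comp_cancel (tl _ _)) !comp_assoc.
    have E : (t 𝟙 ⊗₁ t X) ∘ (lax0 (mon_lax S) ⊗₁ idm (S X))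
        = (lax0 (mon_lax T) ⊗₁ idm (T X)) ∘ (idm 𝟙 ⊗₁ t X).
      by rewrite -!tensor_hom_comp t0 !comp_id_l !comp_id_r.
    by rewrite (comp_cancel E) comp_assoc (lax_lunit TL) lunit_natural.
  + move=> X; apply: (mono).
    rewrite !comp_assoc naturality (comp_cancel (tl _ _)) !comp_assoc.
    have E : (t X ⊗₁ t 𝟙) ∘ (idm (S X) ⊗₁ lax0 (mon_lax S))
        = (idm (T X) ⊗₁ lax0 (mon_lax T)) ∘ (t X ⊗₁ idm 𝟙).
      by rewrite -!tensor_hom_comp t0 !comp_id_l !comp_id_r.
    by rewrite (comp_cancel E) comp_assoc (lax_runit TL) runit_natural.
- split.
  + by apply: (mono); rewrite /= comp_id_r tu t0 -Tu0 /= comp_id_r.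
  + move=> X Y; apply: (mono); rewrite /= comp_id_r tu comp_assoc tl.
    rewrite -comp_assoc -tensor_hom_comp !tu.
    by have := Tu X Y; rewrite /= comp_id_r.
- split.
  + apply: (mono); rewrite t0 /= comp_assoc tm -Tm0 /=.
    by rewrite -!comp_assoc !(comp_assoc (fmap S _)) -(fmap_comp S) t0
      (comp_assoc (t _)) naturality -comp_assoc t0.
  + move=> X Y; apply: (mono); rewrite [in RHS]comp_assoc tl.
    rewrite -[in RHS]comp_assoc -tensor_hom_comp !tm !tmE.
    rewrite tensor_hom_comp [in RHS]comp_assoc -Tm /= comp_assoc tm tmE.
    rewrite tensor_hom_comp !comp_assoc (comp_cancel (lax_natural TL _ _)).
    rewrite (comp_cancel (naturality t _)) comp_assoc (comp_cancel (tl _ _)).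
    by rewrite !comp_assoc -!(comp_assoc (mon_mul T _)) -!(fmap_comp T) tl.
Qed.

(** * The two monads of a monoidal adjunction and their comparison *)

Section AdjunctionMonad.

Context {C D : monoidal_category} (adj : monoidal_adjunction C D).

Local Notation G := (ladj adj).
Local Notation R := (radj adj).
Local Notation η := (adj_unit adj).
Local Notation ε := (adj_counit adj).
Local Notation M := (R 𝟙).
Local Notation "f • g" := (lax_prod (L := rlax adj) f g)
  (at level 40, left associativity).

(** The monad laws are the triangle identities and naturality of ε. For the multiplication,
    naturality moves ε past the structure of G, after which monoidality of ε applies under R. *)
Lemma adj_monad_monoidal : is_monoidal_monad (adj_monad adj).
Proof.
split=> /=.
- by move=> X; apply: adj_triangle_r.
- by move=> X; rewrite -fmap_comp adj_triangle_l fmap_id.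
- move=> X; rewrite -!fmap_comp; congr (fmap R _).
  exact: esym (naturality ε (ε (G X))).
- exact: lax_comp_monoidal (llax_monoidal adj) (rlax_monoidal adj).
- exact: adj_unit_monoidal.
- have [/= E0 E] := adj_counit_monoidal adj; rewrite comp_assoc in E0.
  split=> /=.
  + have N := naturality ε (lax0 (llax adj)); rewrite /= in N.
    rewrite !fmap_comp !comp_assoc -!fmap_comp N.
    by rewrite (comp_cancel3 E0) comp_id_r.
  + move=> X Y.
    have N := naturality ε (lax (llax adj) X Y); rewrite /= in N.
    rewrite !fmap_comp !comp_assoc -!fmap_comp N.
    have E' := E (G X) (G Y); rewrite comp_assoc comp_id_l in E'.
    rewrite (comp_cancel3 E').
    rewrite -(comp_assoc _ (lax (rlax adj) _ _)) (lax_natural (rlax_monoidal adj)).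
    by rewrite comp_assoc -fmap_comp.
Qed.

Lemma adj_unit_tunit : η 𝟙 = fmap R (lax0 (llax adj)) ∘ lax0 (rlax adj).
Proof.
by case: (adj_unit_monoidal adj) => /= E _; rewrite -E comp_id_r.
Qed.

Lemma adj_unit_tensor A B : η (A ⊗ B) = fmap R (lax (llax adj) A B) ∘ (η A • η B).
Proof.
case: (adj_unit_monoidal adj) => /= _ E.
by rewrite -(comp_id_r (η _)) E lax_prodE comp_assoc.
Qed.

Lemma lproj1E A : lproj1 adj A = fmap R (fwd (runit (G A))) ∘ (η A • idm M).
Proof. by rewrite lax_prodE. Qed.

Lemma mulM_lax_prod : mulM adj = fmap R (fwd (lunit 𝟙)) ∘ (idm M • idm M).
Proof. by rewrite lax_prod_id. Qed.

(** The unit of M is [lax0] of R, so this is the right unit law of •. *)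
Lemma lproj1_unit A :
  lproj1 adj A ∘ ((idm A ⊗₁ unitM adj) ∘ bwd (runit A)) = η A.
Proof.
rewrite lproj1E comp_assoc (comp_cancel (esym (lax_prod_compr _ _ _))) comp_id_l.
by rewrite (lax_prod_unitr (rlax_monoidal adj)) (comp_cancel (fwdK _)) comp_id_r.
Qed.

Lemma lproj1_mul A :
  lproj1 adj A ∘ ((idm A ⊗₁ mulM adj) ∘ fwd (assoc A M M))
  = fmap R (ε (G A)) ∘ (lproj1 adj (R (G A)) ∘ (lproj1 adj A ⊗₁ idm M)).
Proof.
have RL := rlax_monoidal adj.
(* The triangle identity cancels η at R(GA) against ε; both sides then become (η A • id) • id up to
   maps in D related by the triangle axiom. *)
have counitE : fmap R (ε (G A)) ∘ lproj1 adj (R (G A))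
    = fmap R (fwd (runit (G A))) ∘ (idm (R (G A)) • idm M).
  rewrite lproj1E comp_assoc -fmap_comp -runit_natural fmap_comp.
  by rewrite -comp_assoc -(lax_prod_fmapl RL) adj_triangle_r.
rewrite [in RHS]comp_assoc counitE (comp_cancel (esym (lax_prod_compl _ _ _))) comp_id_l.
rewrite !lproj1E (lax_prod_fmapl RL) comp_assoc -fmap_comp.
rewrite comp_assoc (comp_cancel (esym (lax_prod_compr _ _ _))) comp_id_l.
rewrite mulM_lax_prod (lax_prod_fmapr RL) comp_assoc -fmap_comp.
rewrite (comp_cancel (esym (lax_prod_assoc RL _ _ _))) comp_assoc -fmap_comp.
congr (fmap R _ ∘ _).
by rewrite -comp_assoc triangle.
Qed.

Lemma lproj1_lax0 :
  lproj1 adj 𝟙 ∘ (bwd (lunit M) ∘ unitM adj)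
  = fmap R (lax0 (llax adj)) ∘ lax0 (rlax adj).
Proof.
have RL := rlax_monoidal adj.
rewrite lproj1E adj_unit_tunit (lax_prod_fmapl RL) comp_assoc -fmap_comp.
(* The two unitors of 𝟙 agree, so the left unit law of • applies. *)
rewrite runit_natural -lunit_tunit comp_assoc fmap_comp.
rewrite (comp_cancel (lax_prod_unitl RL _)) comp_id_l.
by rewrite (comp_cancel (fwdK _)) comp_id_r.
Qed.

Lemma lproj1_inverse (pf : projection_formula adj) A :
  is_inverse (lproj1 adj A)
    (inv_of (lproj_iso pf A 𝟙) ∘ fmap R (bwd (runit (G A)))).
Proof.
apply: is_inverse_comp (inv_ofP (lproj_iso pf A 𝟙)) _.
exact: is_inverse_fmap (isoP (runit (G A))).
Qed.

(** The inverse of [lproj] inside [swap] cancels; the result is the rule that exchanges η with the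
    identity of M. *)
Lemma lproj_swap (pf : projection_formula adj) A :
  (η A • idm M) ∘ swap pf A
  = fmap R (bwd (runit (G A)) ∘ fwd (lunit (G A))) ∘ (idm M • η A).
Proof.
case: (inv_ofP (lproj_iso pf A 𝟙)) => _ K.
by rewrite /swap /rproj1 /rproj !lax_prodE !comp_assoc K comp_id_l fmap_comp.
Qed.

(** Monoidality of η makes both sides products of η A, η B and two identities of M; one exchange by
    [lproj_swap] matches their order. *)
Lemma lproj1_lax (pf : projection_formula adj) A B :
  lproj1 adj (A ⊗ B) ∘ lax (tensorM_lax pf) A B
  = fmap R (lax (llax adj) A B) ∘ (lproj1 adj A • lproj1 adj B).
Proof.
have RL := rlax_monoidal adj.
(* Coherence expands the tensor of right unitors into the path followed in [tensorM_lax], now in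
   D. *)
rewrite !lproj1E (lax_prod_fmap RL) -runit_swap_coherence /= !comp_assoc.
rewrite (comp_cancel (esym (lax_prod_compr _ _ _))) comp_id_l.
rewrite adj_unit_tensor mulM_lax_prod (lax_prod_fmap RL).
rewrite !comp_assoc (comp_cancel (lax_prod_assoc_bwd RL _ _ _)).
rewrite !comp_assoc (comp_cancel (esym (lax_prod_compr _ _ _))).
(* Rebracketing to (η B • id) • id exposes the factor on which [swap] acts. *)
rewrite -(lax_prod_assoc RL) (lax_prod_fmapr RL).
rewrite !comp_assoc (comp_cancel (esym (lax_prod_compr _ _ _))).
rewrite -lax_prod_compl lproj_swap (lax_prod_fmapl RL) (lax_prod_fmapr RL).
rewrite !comp_assoc (comp_cancel (esym (lax_prod_compr _ _ _))).
(* The exchanged product is rebracketed to (η A • id) • (η B • id), as on the right-hand side. *)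
rewrite (lax_prod_assoc_bwd RL) (lax_prod_fmapr RL).
rewrite !comp_assoc (comp_cancel (esym (lax_prod_assoc RL _ _ _))).
rewrite !comp_assoc -!fmap_comp; congr (fmap R _ ∘ _).
(* Naturality of the right unitor moves the structure map of G past it. *)
have E : fwd (runit (G (A ⊗ B))) ∘ (lax (llax adj) A B ⊗₁ fwd (lunit 𝟙))
   = lax (llax adj) A B ∘ fwd (runit (G A ⊗ G B))
       ∘ (idm (G A ⊗ G B) ⊗₁ fwd (lunit 𝟙)).
  by rewrite -runit_natural -comp_assoc -tensor_hom_comp comp_id_l comp_id_r.
by rewrite E !comp_assoc.
Qed.

End AdjunctionMonad.

Theorem lemma5p13 (C D : monoidal_category) (adj : monoidal_adjunction C D)
    (pf : projection_formula adj) :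
  @is_monoidal_monad_iso C (tensorM_monad pf) (adj_monad adj) (lproj1 adj).
Proof.
have inv := lproj1_inverse adj pf.
have lproj1_monoidal :
    is_monoidal_trans (tensorM_lax pf) (lax_comp (rlax adj) (llax adj))
      (lproj1 adj).
  split; first exact: lproj1_lax0.
  by move=> A B; rewrite lproj1_lax lax_prodE comp_assoc.
split.
- apply: (@monoidal_monad_transport _ (tensorM_monad pf) (adj_monad adj)
    (lproj1 adj) _ inv) => //.
  + exact: lproj1_unit.
  + exact: lproj1_mul.
  + exact: adj_monad_monoidal.
- exact: adj_monad_monoidal.
- exact: lproj1_unit.
- exact: lproj1_mul.
- exact: lproj1_monoidal.
- by move=> A; eexists; apply: inv.
Qed.
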